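(* Let $M$ be a simple weight $H$-module (not assumed finite dimensional). Then $M$ is finite dimensional. Moreover: (a) If $\dim M=1$, then $M\cong V_{\lambda}$ for some $\lambda\in\widehat{G}$. (b) If $\dim M>1$, then $|\chi|=s<\infty$ and $M\cong V(\lambda,f)$ for some $\lambda\in\widehat{G}$ and $f(y)\in\mathrm{Irr}[y]$.
   Context: $k$ is a field, $G$ a group, $\widehat{G}$ the group of characters $G\to k^{\times}$, $\chi\in\widehat{G}$ of order $|\chi|$ (possibly $\infty$), and $a\in Z(G)$ with $\chi(a)\neq 1$. $H=kG(\chi^{-1},a,0)$ is the Hopf algebra generated as an algebra by $G$ and $x$ with relations $xg=\chi^{-1}(g)gx$ ($g\in G$), having $k$-basis $\{gx^i\mid g\in G,i\geq 0\}$, with $\Delta(x)=x\otimes a+1\otimes x$, $\varepsilon(x)=0$, $S(x)=-xa^{-1}$, and each $g\in G$ group-like. For an $H$-module $M$ and $\lambda\in\widehat{G}$, $M_{(\lambda)}=\{v\in M\mid g\cdot v=\lambda(g)v\ \forall g\in G\}$. $M$ is a weight module if $M=\bigoplus_{\lambda\in\widehat{G}}M_{(\lambda)}$. $V_{\lambda}$ ($\lambda\in\widehat{G}$) is the $1$-dimensional $H$-module with $g\cdot v=\lambda(g)v$, $x\cdot v=0$. $V(\lambda,f)$: assume $|\chi|=s<\infty$. For $\lambda\in\widehat{G}$ and a monic polynomial $f(y)=y^n-\sum_{j=0}^{n-1}\alpha_jy^j\in k[y]$ of degree $n\geq 1$, $V(\lambda,f)$ is the $H$-module with $k$-basis $m_0,\dots,m_{ns-1}$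 and action $g\cdot m_i=\chi^i(g)\lambda(g)m_i$; $x\cdot m_i=m_{i+1}$ for $0\leq i\leq ns-2$; $x\cdot m_{ns-1}=\sum_{j=0}^{n-1}\alpha_jm_{js}$. $\mathrm{Irr}[y]$ is the set of monic irreducible polynomials $f(y)\in k[y]$ with $f(y)\neq y$. *)

(* Defs.v *)
From HB Require Import structures.
From mathcomp Require Import all_boot all_algebra.
From mathcomp Require Import finmap.
From mathcomp.multinomials Require Import monalg.

Set Implicit Arguments.
Unset Strict Implicit.
Unset Printing Implicit Defensive.

Import GRing.Theory.
Local Open Scope ring_scope.

(* The values are automatically nonzero, since l g * l g^-1 = 1. *)
Record character (k : fieldType) (G : groupType) := Character {
  char_fun :> G -> k;
  char1 : char_fun 1%g = 1;
  charM : forall g h, char_fun (g * h)%g = char_fun g * char_fun h }.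

(* [char_order chi s] says that chi has finite order s in the group of
   characters under pointwise multiplication. *)
Definition char_order (k : fieldType) (G : groupType) (chi : character k G)
    (s : nat) : Prop :=
  [/\ (0 < s)%N,
      forall g, chi g ^+ s = 1
    & forall t, (0 < t)%N -> (forall g, chi g ^+ t = 1) -> (s <= t)%N].

(* [A2], with [tens], is the algebra A (x) A. *)
Definition is_tensor_square (k : fieldType) (A A2 : algType k)
    (tens : {bilinear A -> A -> A2}) : Prop :=
  [/\ forall (W : lmodType k) (b : {bilinear A -> A -> W}),
        exists f : {linear A2 -> W},
          (forall u v, f (tens u v) = b u v) /\
          forall f' : {linear A2 -> W},
            (forall u v, f' (tens u v) = b u v) -> f' =1 f,
      tens 1 1 = 1
    & forall u v u' v', tens u v * tens u' v' = tens (u * u') (v * v')].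

(* [d] picks for every u a representative \sum u_(1) (x) u_(2) of Delta u. *)
Definition is_sweedler (k : fieldType) (A A2 : algType k)
    (tens : A -> A -> A2) (Delta : A -> A2) (d : A -> seq (A * A)) : Prop :=
  forall u, Delta u = \sum_(p <- d u) tens p.1 p.2.

(* The identities are stated on Sweedler representatives. Coassociativity, an
   equality in A (x) A (x) A, is tested by all trilinear maps. *)
Record hopfAlgebra (k : fieldType) := HopfAlgebra {
  hopf_alg :> algType k;
  hopf_sq : algType k;
  tens : {bilinear hopf_alg -> hopf_alg -> hopf_sq};
  tensP : is_tensor_square tens;
  comul : {lrmorphism hopf_alg -> hopf_sq};
  counit : {lrmorphism hopf_alg -> k^o};
  antipode : {linear hopf_alg -> hopf_alg};
  coassoc : forall d, is_sweedler tens comul d ->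
    forall (W : lmodType k) (t : hopf_alg -> hopf_alg -> hopf_alg -> W),
    (forall v w, linear (fun u => t u v w)) ->
    (forall u w, linear (fun v => t u v w)) ->
    (forall u v, linear (fun w => t u v w)) ->
    forall u, \sum_(p <- d u) \sum_(q <- d p.1) t q.1 q.2 p.2
            = \sum_(p <- d u) \sum_(q <- d p.2) t p.1 q.1 q.2;
  counitl : forall d, is_sweedler tens comul d ->
    forall u, \sum_(p <- d u) (counit p.1 : k) *: p.2 = u;
  counitr : forall d, is_sweedler tens comul d ->
    forall u, \sum_(p <- d u) (counit p.2 : k) *: p.1 = u;
  antipodel : forall d, is_sweedler tens comul d ->
    forall u, \sum_(p <- d u) antipode p.1 * p.2 = (counit u : k)%:A;
  antipoder : forall d, is_sweedler tens comul d ->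
    forall u, \sum_(p <- d u) p.1 * antipode p.2 = (counit u : k)%:A }.

Arguments tens {k h}.
Arguments comul {k} h.
Arguments counit {k} h.
Arguments antipode {k} h.

(* The linear extension of F to the free k-module on K. *)
Section MalgLift.
Variables (k : fieldType) (K : choiceType) (W : lmodType k) (F : K -> W).
Implicit Types u v : {malg k[K]}.

Definition malg_lift u : W := \sum_(p <- msupp u) u@_p *: F p.

Lemma malg_liftw (d : {fset K}) u : (msupp u `<=` d)%fset ->
  malg_lift u = \sum_(p <- d) u@_p *: F p.
Proof.
move=> le_d; rewrite /malg_lift (big_fset_incl _ le_d) //= => p _.
by move/mcoeff_outdom->; rewrite scale0r.
Qed.

Lemma malg_liftD u v : malg_lift (u + v) = malg_lift u + malg_lift v.
Proof.
rewrite (malg_liftw (msuppD_le u v)) (malg_liftw (fsubsetUl _ (msupp v))).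
rewrite (malg_liftw (fsubsetUr (msupp u) _)) -big_split /=.
by apply: eq_bigr => p _; rewrite mcoeffD scalerDl.
Qed.

Lemma malg_liftZ c u : malg_lift (c *: u) = c *: malg_lift u.
Proof.
rewrite (malg_liftw (msuppZ_le c u)) scaler_sumr.
by apply: eq_bigr => p _; rewrite mcoeffZ scalerA.
Qed.

Fact malg_lift_linear : linear malg_lift.
Proof. by move=> c u v; rewrite malg_liftD malg_liftZ. Qed.

HB.instance Definition _ :=
  GRing.isLinear.Build k {malg k[K]} W *:%R malg_lift malg_lift_linear.

Lemma malg_liftU p : malg_lift << p >> = F p.
Proof.
by rewrite (malg_liftw msuppU_le) big_seq_fset1 mcoeffUU scale1r.
Qed.
End MalgLift.

(* The map from the free k-module on G * nat sending (g, i) to g x^i. *)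
Definition gx_comb (k : fieldType) (G : groupType) (A : algType k)
    (grp : G -> A) (x : A) : {malg k[(G * nat)%type]} -> A :=
  malg_lift (fun p => grp p.1 * x ^+ p.2).

Fact gx_comb_linear (k : fieldType) (G : groupType) (A : algType k)
  (grp : G -> A) (x : A) : linear (gx_comb grp x).
Proof. exact: malg_lift_linear. Qed.

HB.instance Definition _ (k : fieldType) (G : groupType) (A : algType k)
    (grp : G -> A) (x : A) :=
  GRing.isLinear.Build k _ A *:%R (gx_comb grp x) (gx_comb_linear grp x).

Lemma gx_combE (k : fieldType) (G : groupType) (A : algType k)
    (grp : G -> A) (x : A) u :
  gx_comb grp x u = \sum_(p <- msupp u) u@_p *: (grp p.1 * x ^+ p.2).
Proof. by []. Qed.

Lemma gx_combU (k : fieldType) (G : groupType) (A : algType k)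
    (grp : G -> A) (x : A) p : gx_comb grp x << p >> = grp p.1 * x ^+ p.2.
Proof. exact: malg_liftU. Qed.

(* The Hopf algebra kG(chi^-1, a, 0): the basis {g x^i} and the relations
   determine it up to isomorphism. *)
Record oreHopf (k : fieldType) (G : groupType) (chi : character k G) (a : G) :=
  OreHopf {
  ore_hopf :> hopfAlgebra k;
  grp : G -> ore_hopf;
  gen : ore_hopf;
  grp1 : grp 1%g = 1;
  grpM : forall g h, grp (g * h)%g = grp g * grp h;
  gen_grp : forall g, gen * grp g = (chi g)^-1 *: (grp g * gen);
  gx_basis : bijective (gx_comb grp gen);
  comul_gen : comul ore_hopf gen = tens gen (grp a) + tens 1 gen;
  counit_gen : counit ore_hopf gen = 0;
  antipode_gen : antipode ore_hopf gen = - (gen * grp a^-1%g);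
  comul_grp : forall g, comul ore_hopf (grp g) = tens (grp g) (grp g);
  counit_grp : forall g, counit ore_hopf (grp g) = 1;
  antipode_grp : forall g, antipode ore_hopf (grp g) = grp g^-1%g }.

Arguments grp {k G chi a o}.
Arguments gen {k G chi a o}.

(* Restriction of scalars of an A-module along k -> A. *)
Definition res (k : fieldType) (A : algType k) (M : lmodType A) : Type := M.

Section Res.
Variables (k : fieldType) (A : algType k) (M : lmodType A).
HB.instance Definition _ := GRing.Zmodule.on (res M).

Definition res_scale (c : k) (v : res M) : res M := (c%:A : A) *: (v : M).

Fact res_scaleA c d v : res_scale c (res_scale d v) = res_scale (c * d) v.
Proof. by rewrite /res_scale scalerA -scalerAl mul1r scalerA. Qed.

Fact res_scale1 : left_id 1 res_scale.
Proof. by move=> v; rewrite /res_scale scale1r; apply: scale1r. Qed.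

Fact res_scaleDr : right_distributive res_scale +%R.
Proof. by move=> c u v; rewrite /res_scale; apply: scalerDr. Qed.

Fact res_scaleDl v : {morph res_scale^~ v : c d / c + d}.
Proof. by move=> c d; rewrite /res_scale scalerDl; apply: scalerDl. Qed.

HB.instance Definition _ := GRing.Zmodule_isLmodule.Build k (res M)
  res_scaleA res_scale1 res_scaleDr res_scaleDl.
End Res.

Definition has_dim (k : fieldType) (A : algType k) (M : lmodType A) (n : nat) :
    Prop :=
  exists r : {linear res M -> 'rV[k]_n}, bijective r.

Definition isomorphic (A : nzRingType) (M N : lmodType A) : Prop :=
  exists f : {linear M -> N}, bijective f.

(* Submodules are arbitrary (possibly undecidable) subsets. *)
Definition simple_module (A : nzRingType) (M : lmodType A) : Prop :=
  (exists v : M, v != 0) /\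
  forall P : M -> Prop,
    P 0 -> (forall c u v, P u -> P v -> P (c *: u + v)) ->
    (forall v, P v -> v = 0) \/ (forall v, P v).

Section Modules.
Variables (k : fieldType) (G : groupType) (chi : character k G) (a : G).
Variable H : oreHopf chi a.

Definition weight (M : lmodType H) (lam : character k G) (v : M) : Prop :=
  forall g, grp g *: v = ((lam g)%:A : H) *: v.

Definition weight_module (M : lmodType H) : Prop :=
  (forall v : M, exists n (lam : 'I_n -> character k G) (w : 'I_n -> M),
     (forall i, weight (lam i) (w i)) /\ v = \sum_i w i) /\
  (forall n (lam : 'I_n -> character k G) (w : 'I_n -> M),
     (forall i j, lam i =1 lam j -> i = j) ->
     (forall i, weight (lam i) (w i)) ->
     \sum_i w i = 0 -> forall i, w i = 0).

Lemma gx_surj (h : H) : exists u, gx_comb grp gen u == h.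
Proof. by have [c _ cK] := gx_basis H; exists (c h); rewrite cK. Qed.

Definition gx_coord (h : H) : {malg k[(G * nat)%type]} := xchoose (gx_surj h).

Lemma gx_coordK : cancel gx_coord (gx_comb grp gen).
Proof. by move=> h; exact: (eqP (xchooseP (gx_surj h))). Qed.

Lemma gx_combK : cancel (gx_comb (grp : G -> H) gen) gx_coord.
Proof. by move=> u; apply: (bij_inj (gx_basis H)); rewrite gx_coordK. Qed.

Lemma gen_exp_grp i g :
  (gen : H) ^+ i * grp g = ((chi g)^-1 ^+ i) *: (grp g * gen ^+ i).
Proof.
elim: i => [|i IH]; first by rewrite !expr0 mul1r mulr1 scale1r.
rewrite [in LHS]exprS -mulrA IH -scalerAr mulrA gen_grp -scalerAl scalerA.
by rewrite -mulrA -exprS -exprSr.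
Qed.

(* An H-module structure on a k-space W is an action of G and of x on W
   satisfying the relations of H. *)
Record gx_action (W : lmodType k) := GxAction {
  gact : G -> W -> W;
  xact : W -> W;
  gact_lin : forall g, linear (gact g);
  xact_lin : linear xact;
  gact1 : forall w, gact 1%g w = w;
  gactM : forall g h w, gact (g * h)%g w = gact g (gact h w);
  xgact : forall g w, xact (gact g w) = (chi g)^-1 *: gact g (xact w) }.

Definition gx_mod (W : lmodType k) (r : gx_action W) : Type := W.

Section GxMod.
Variables (W : lmodType k) (r : gx_action W).

HB.instance Definition _ := GRing.Zmodule.on (gx_mod r).

HB.instance Definition _ g :=
  GRing.isLinear.Build k W W *:%R (gact r g) (gact_lin r g).
HB.instance Definition _ :=
  GRing.isLinear.Build k W W *:%R (xact r) (xact_lin r).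

Definition basis_act (w : W) (p : G * nat) : W :=
  gact r p.1 (iter p.2 (xact r) w).

Definition gx_smul (h : H) (w : gx_mod r) : gx_mod r :=
  malg_lift (basis_act w) (gx_coord h).

Let act_comb u w : gx_smul (gx_comb grp gen u) w = malg_lift (basis_act w) u.
Proof. by rewrite /gx_smul gx_combK. Qed.

Let iter_lin i c u v :
  iter i (xact r) (c *: u + v) = c *: iter i (xact r) u + iter i (xact r) v.
Proof. by elim: i => //= i IH; rewrite IH linearP. Qed.

Let basis_act_lin p : linear (basis_act^~ p).
Proof. by move=> c u v; rewrite /basis_act iter_lin linearP. Qed.

Let iter_gact i g w :
  iter i (xact r) (gact r g w) =
  ((chi g)^-1 ^+ i) *: gact r g (iter i (xact r) w).
Proof.
elim: i => [|i IH]; first by rewrite expr0 scale1r.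
by rewrite /= IH linearZ /= xgact scalerA exprSr.
Qed.

Fact gx_actA u v w : gx_smul u (gx_smul v w) = gx_smul (u * v) w.
Proof.
rewrite -(gx_coordK u) -(gx_coordK v).
move: (gx_coord u) (gx_coord v) => {}u {}v.
pose t (p q : G * nat) : {malg k[(G * nat)%type]} :=
  ((chi q.1)^-1 ^+ p.2) *: << ((p.1 * q.1)%g, (p.2 + q.2)%N) >>.
have -> : gx_comb grp gen u * gx_comb grp gen v =
    gx_comb grp (gen : H) (malg_lift (fun p => malg_lift (t p) v) u).
  rewrite [malg_lift _ u]/malg_lift linear_sum gx_combE mulr_suml.
  apply: eq_bigr => p _; rewrite linearZ -scalerAl /=; congr (_ *: _).
  rewrite /malg_lift linear_sum gx_combE mulr_sumr.
  apply: eq_bigr => q _; rewrite linearZ -scalerAr /=; congr (_ *: _).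
  rewrite /t linearZ /= gx_combU grpM exprD.
  rewrite -!mulrA [gen ^+ _ * (grp _ * _)]mulrA gen_exp_grp.
  by rewrite -scalerAl -scalerAr !mulrA.
rewrite !act_comb [X in _ = malg_lift _ X]/malg_lift linear_sum [LHS]/malg_lift.
apply: eq_bigr => p _; rewrite linearZ /=; congr (_ *: _).
pose F : {linear W -> W} :=
  HB.pack (basis_act^~ p) (GRing.isLinear.Build k W W *:%R _ (basis_act_lin p)).
rewrite -[LHS]/(F _) [in LHS]/malg_lift linear_sum.
rewrite [X in malg_lift _ X]/malg_lift linear_sum; apply: eq_bigr => q _.
rewrite linearZ [in RHS]linearZ /=; congr (_ *: _).
rewrite /t malg_liftZ malg_liftU /basis_act /= gactM iter_gact.
by rewrite linearZ /= iterD.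
Qed.

Fact gx_act1 : left_id 1 gx_smul.
Proof.
move=> w; have -> : 1 = gx_comb grp (gen : H) << (1%g, 0%N) >>.
  by rewrite gx_combU /= grp1 mul1r.
by rewrite act_comb malg_liftU /basis_act /= gact1.
Qed.

Fact gx_actDr : right_distributive gx_smul +%R.
Proof.
move=> h u v; rewrite /gx_smul /malg_lift -big_split /=; apply: eq_bigr => p _.
rewrite -scalerDr; congr (_ *: _).
by have /(_ 1 u v) := basis_act_lin p; rewrite !scale1r.
Qed.

Fact gx_actDl w : {morph gx_smul^~ w : u v / u + v}.
Proof.
move=> u v; rewrite -(gx_coordK u) -(gx_coordK v).
by rewrite -linearD !act_comb malg_liftD.
Qed.

HB.instance Definition _ := GRing.Zmodule_isLmodule.Build H (gx_mod r)
  gx_actA gx_act1 gx_actDr gx_actDl.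

Lemma gx_grpE g (w : gx_mod r) : (grp g : H) *: w = gact r g w.
Proof.
have -> : grp g = gx_comb grp (gen : H) << (g, 0%N) >>.
  by rewrite gx_combU /= mulr1.
by rewrite -[LHS]/(gx_smul _ w) act_comb malg_liftU.
Qed.

Lemma gx_genE (w : gx_mod r) : (gen : H) *: w = xact r w.
Proof.
have -> : gen = gx_comb grp (gen : H) << (1%g, 1%N) >>.
  by rewrite gx_combU /= grp1 mul1r.
by rewrite -[LHS]/(gx_smul _ w) act_comb malg_liftU /basis_act /= gact1.
Qed.

Lemma gx_scaleE (c : k) (w : gx_mod r) : (c%:A : H) *: w = c *: (w : W).
Proof.
have -> : c%:A = gx_comb grp (gen : H) (c *: << (1%g, 0%N) >>).
  by rewrite linearZ /= gx_combU /= grp1 mul1r.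
by rewrite -[LHS]/(gx_smul _ w) act_comb malg_liftZ malg_liftU /basis_act /= gact1.
Qed.
End GxMod.

Section VLambda.
Variable lam : character k G.

Definition V_gact (g : G) (w : k^o) : k^o := lam g *: w.
Definition V_xact (w : k^o) : k^o := 0.

Fact V_gact_lin g : linear (V_gact g).
Proof. by move=> c u v; rewrite /V_gact scalerDr !scalerA mulrC. Qed.

Fact V_xact_lin : linear V_xact.
Proof. by move=> c u v; rewrite /V_xact scaler0 addr0. Qed.

Fact V_gact1 w : V_gact 1%g w = w.
Proof. by rewrite /V_gact char1 scale1r. Qed.

Fact V_gactM g h w : V_gact (g * h)%g w = V_gact g (V_gact h w).
Proof. by rewrite /V_gact charM scalerA. Qed.

Fact V_xgact g w : V_xact (V_gact g w) = (chi g)^-1 *: V_gact g (V_xact w).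
Proof. by rewrite /V_xact /V_gact !scaler0. Qed.

Definition V_action : gx_action k^o :=
  GxAction V_gact_lin V_xact_lin V_gact1 V_gactM V_xgact.

Definition V_lam : lmodType H := gx_mod V_action.
End VLambda.

Section VLambdaF.
Variables (s : nat) (s_chi : char_order chi s).
Variables (lam : character k G) (f : {poly k}).

Local Notation n := (size f).-1.
Local Notation W := 'rV[k]_(n * s).

(* f = y^n - \sum_(j < n) alpha_j y^j when f is monic. *)
Definition Vf_alpha (j : nat) : k := - f`_j.

Definition Vf_m (i : nat) : W := \row_l (l == i :> nat)%:R.

Definition Vf_xm (i : nat) : W :=
  if (i.+1 < n * s)%N then Vf_m i.+1
  else \sum_(j < n) Vf_alpha j *: Vf_m (j * s).

(* The linear maps m_i |-> chi^i(g) lam(g) m_i and m_i |-> x m_i. *)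
Definition Vf_gact (g : G) (w : W) : W :=
  \sum_(i < n * s) w 0 i *: ((chi g ^+ i * lam g) *: Vf_m i).

Definition Vf_xact (w : W) : W := \sum_(i < n * s) w 0 i *: Vf_xm i.

Let gaE g w i : Vf_gact g w 0 i = w 0 i * (chi g ^+ i * lam g).
Proof.
rewrite /Vf_gact summxE (bigD1 i) //= big1 ?addr0 => [|j ji]; rewrite !mxE.
  by rewrite eqxx mulr1.
by rewrite -val_eqE eq_sym in ji; rewrite (negPf ji) !mulr0.
Qed.

Let chi_neq0 g : chi g != 0.
Proof.
apply/eqP => g0; have := charM chi g g^-1%g.
by rewrite mulgV char1 g0 mul0r => /eqP; rewrite oner_eq0.
Qed.

Fact Vf_gact_lin g : linear (Vf_gact g).
Proof.
by move=> c u v; apply/rowP=> i; rewrite !mxE !gaE !mxE mulrDl -!mulrA.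
Qed.

Fact Vf_xact_lin : linear Vf_xact.
Proof.
move=> c u v; rewrite /Vf_xact scaler_sumr -big_split /=; apply: eq_bigr => i _.
by rewrite !mxE scalerDl scalerA.
Qed.

Fact Vf_gact1 w : Vf_gact 1%g w = w.
Proof. by apply/rowP=> i; rewrite gaE !char1 expr1n !mulr1. Qed.

Fact Vf_gactM g h w : Vf_gact (g * h)%g w = Vf_gact g (Vf_gact h w).
Proof.
apply/rowP=> i; rewrite !gaE !charM exprMn -mulrA; congr (_ * _).
by rewrite mulrACA [RHS]mulrC.
Qed.

Let chi_mod g i : chi g ^+ i = chi g ^+ (i %% s).
Proof.
have [_ Es _] := s_chi; rewrite {1}(divn_eq i s) exprD mulnC exprM.
by rewrite Es expr1n mul1r.
Qed.

Let Vf_gact_xm g (i : 'I_(n * s)) :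
  Vf_gact g (Vf_xm i) = (chi g ^+ i.+1 * lam g) *: Vf_xm i.
Proof.
apply/rowP=> l; rewrite gaE !mxE mulrC /Vf_xm; case: ltnP => lti.
  by rewrite !mxE; case: eqP => [->|]; rewrite ?mulr0.
have Ei : i.+1 = (n * s)%N by apply/eqP; rewrite eqn_leq lti ltn_ord.
rewrite !summxE !mulr_sumr; apply: eq_bigr => j _; rewrite !mxE.
case: eqP => [->|]; last by rewrite !mulr0.
by rewrite Ei chi_mod [in RHS]chi_mod !modnMl.
Qed.

Fact Vf_xgact g w : Vf_xact (Vf_gact g w) = (chi g)^-1 *: Vf_gact g (Vf_xact w).
Proof.
pose F : {linear W -> W} :=
  HB.pack (Vf_gact g) (GRing.isLinear.Build k _ _ *:%R _ (Vf_gact_lin g)).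
rewrite -[Vf_gact g (Vf_xact w)]/(F _) /Vf_xact [F _]raddf_sum scaler_sumr.
apply: eq_bigr => i _; rewrite -[RHS]/(_ *: F (_ *: Vf_xm i)) linearZ /=.
rewrite Vf_gact_xm gaE !scalerA; congr (_ *: _).
by rewrite exprS -!mulrA [RHS]mulrCA mulKf.
Qed.

Lemma Vf_gact_m g i : Vf_gact g (Vf_m i) = (chi g ^+ i * lam g) *: Vf_m i.
Proof.
apply/rowP=> l; rewrite gaE !mxE; case: eqP => [->|]; rewrite ?mul1r ?mulr1 //.
by rewrite mul0r mulr0.
Qed.

Lemma Vf_xact_m (i : 'I_(n * s)) : Vf_xact (Vf_m i) = Vf_xm i.
Proof.
rewrite /Vf_xact (bigD1 i) //= !mxE eqxx scale1r big1 ?addr0 // => j ji.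
by rewrite !mxE val_eqE (negPf ji) scale0r.
Qed.

Definition Vf_action : gx_action W :=
  GxAction Vf_gact_lin Vf_xact_lin Vf_gact1 Vf_gactM Vf_xgact.

(* V(lambda, f); only meaningful for monic f of degree n >= 1. *)
Definition V_lamf : lmodType H := gx_mod Vf_action.
End VLambdaF.
End Modules.

Definition Irr (k : fieldType) (f : {poly k}) : Prop :=
  [/\ f \is monic, irreducible_poly f & f != 'X].

(* Main.v *)
Require Import Defs.
From HB Require Import structures.
From mathcomp Require Import all_boot all_algebra.
From Stdlib Require Import Classical.

Set Implicit Arguments.
Unset Strict Implicit.
Unset Printing Implicit Defensive.

Import GRing.Theory.
Local Open Scope ring_scope.

(** Let w be a nonzero weight vector of M. Every g in G multiplies x^i w by a
    scalar, so H w is the set of all p(x) w with p in k[X], and by simplicity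
    this is M ([simple_cyclic]). If x w = 0, then M is the line through w and
    is some V_lambda ([killed_iso]).

    Suppose that x w is not 0. Then x w is a weight vector that generates M,
    so w = p(x) x w for some p, and the ideal I of all q with q(x) w = 0
    contains 1 - pX. Hence I has a monic generator d, and d(0) is not 0. An
    element g of G sends q(x) w to a multiple of q(chi(g) X)(x) w, so I is
    stable under the substitution of chi(g) X for X. This substitution keeps
    the degree and the constant coefficient of d, so it fixes d: chi(g)^i = 1
    for all g whenever X^i occurs in d ([dvdp_scaleX_expr1]). As d is not
    constant, chi has finite order s; moreover d = f(X^s) for a monic f with
    f(0) nonzero.

    The polynomial f is irreducible because, for a divisor u of f, the vector
    u(x^s) w has the same weight as w, so it vanishes or generates M, and in
    the latter case the cofactor (f/u)(x^s) kills M. Thus M is k[X]/(f(X^s)) as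
    a k[x]-module, with x^i w in the role of m_i, and this is V(lambda, f)
    ([cyclic_iso]).

    The dimension is 1 in the first case and s deg f in the second. Here
    s > 1 because chi(a) is not 1, so the dimension of M tells the two cases
    apart. *)

(** * Choice of minimal elements and inverses *)

(** Membership in an annihilator is not decidable, so the minimum comes from
    excluded middle instead of [ex_minn]. *)
Lemma classical_ex_min (P : nat -> Prop) :
  (exists n, P n) -> exists2 n, P n & forall i, P i -> (n <= i)%N.
Proof.
case=> n; elim/ltn_ind: n => n IH Pn.
have [[i [lt_in Pi]]|noP] := classic (exists i, (i < n)%N /\ P i).
  exact: IH lt_in Pi.
by exists n => // i Pi; rewrite leqNgt; apply/negP => lt_in; case: noP;
  exists i.
Qed.

Lemma inj_surj_bijective (T : choiceType) (U : eqType) (f : T -> U) :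
  injective f -> (forall v, exists w, v = f w) -> bijective f.
Proof.
move=> f_inj f_surj.
have ex v : exists w, f w == v by have [w ->] := f_surj v; exists w.
have fK : cancel (fun v => xchoose (ex v)) f.
  by move=> v; apply/eqP/(xchooseP (ex v)).
by exists (fun v => xchoose (ex v)) => // w; apply: f_inj; rewrite fK.
Qed.

(** Division with remainder by an element of minimal degree; the ideal is an
    arbitrary predicate. *)
Lemma poly_ideal_principal (k : fieldType) (I : {poly k} -> Prop) :
    (forall p q, I p -> I q -> I (p - q)) -> (forall p q, I q -> I (p * q)) ->
    (exists2 q, q != 0 & I q) ->
  exists2 d, d \is monic & forall p, I p <-> d %| p.
Proof.
move=> IB IM [q q0 Iq].
pose P n := exists q, [/\ q != 0, I q & size q = n].
have [|n [{q0 Iq}e [e0 Ie De]] min_n] := @classical_ex_min P.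
  by exists (size q), q.
pose d := (lead_coef e)^-1 *: e.
have le0 : (lead_coef e)^-1 != 0 by rewrite invr_eq0 lead_coef_eq0.
exists d => [|p]; first by rewrite monicE lead_coefZ mulVf ?lead_coef_eq0.
rewrite dvdpZl //; split=> [Ip|/dvdpP[u ->]]; last exact: IM.
rewrite /dvdp; apply: contraT => r0.
suff /min_n : P (size (p %% e)) by rewrite -De leqNgt ltn_modpN0.
by exists (p %% e); split=> //; rewrite -[_ %% _](addKr (p %/ e * e)) addrC
  -divp_eq; apply: IB (IM _ _ _).
Qed.

(** * Dimension and isomorphism *)

Lemma has_dim_uniq (k : fieldType) (A : algType k) (M : lmodType A)
    (m n : nat) :
  has_dim M m -> has_dim M n -> m = n.
Proof.
suff le i j : has_dim M i -> has_dim M j -> (i <= j)%N.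
  by move=> Mm Mn; apply/eqP; rewrite eqn_leq !le.
move=> [r [r' rK r'K]] [t [t' tK t'K]].
have r'_lin : linear r'.
  by move=> c u v; apply: (can_inj rK); rewrite linearP !r'K.
pose F : {linear 'rV[k]_i -> 'rV[k]_j} :=
  HB.pack (t \o r') (GRing.isLinear.Build k _ _ *:%R (t \o r')
     (fun c u v => etrans (congr1 t (r'_lin c u v)) (linearP t c _ _))).
have Finj : injective F by move=> u v /(can_inj tK)/(can_inj r'K).
have : row_free (lin1_mx F).
  rewrite -kermx_eq0; apply/eqP/row_matrixP => l; rewrite row0; apply: Finj.
  by rewrite linear0 -mul_rV_lin1 -row_mul mulmx_ker row0.
by move/eqP<-; apply: rank_leq_col.
Qed.

Lemma isomorphic_sym (A : nzRingType) (M N : lmodType A) :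
  isomorphic M N -> isomorphic N M.
Proof.
case=> f [g fK gK].
have g_lin : linear g by move=> c u v; apply: (can_inj fK); rewrite linearP !gK.
pose g' : {linear N -> M} :=
  HB.pack g (GRing.isLinear.Build A _ _ *:%R g g_lin).
by exists g'; exists f.
Qed.

(** * Polynomials under the scaling of the variable *)

Lemma coef_comp_polyZX (R : comNzRingType) (c : R) (p : {poly R}) i :
  (p \Po (c *: 'X))`_i = p`_i * c ^+ i.
Proof.
rewrite coef_comp_poly; under eq_bigr => j _ do
  rewrite exprZn coefZ coefXn mulrA.
have [lt_i|le_i] := ltnP i (size p); last first.
  rewrite big1 => [|[j /= lt_j] _]; first by rewrite nth_default ?mul0r.
  by rewrite gtn_eqF ?mulr0 // (leq_trans lt_j).
rewrite (bigD1 (Ordinal lt_i)) //= eqxx mulr1 big1 ?addr0 // => j.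
by rewrite -val_eqE /= eq_sym => /negPf->; rewrite mulr0.
Qed.

(** The two polynomials have the same degree, hence d(cX) is a constant times
    d; the constant is 1 because both have the same nonzero value at 0. *)
Lemma dvdp_scaleX_expr1 (k : fieldType) (c : k) (d : {poly k}) i :
  d`_0 != 0 -> d %| d \Po (c *: 'X) -> d`_i != 0 -> c ^+ i = 1.
Proof.
move=> d0 d_dvd di.
set e := d \Po _ in d_dvd; have e0 : e != 0.
  by apply: contraNneq d0 => e0; rewrite -[d`_0]mulr1 -[1](expr0 c)
    -coef_comp_polyZX -/e e0 coef0.
have : d %= e.
  rewrite -dvdp_size_eqp // eqn_leq dvdp_leq //=; apply/leq_sizeP => j le_j.
  by rewrite coef_comp_polyZX nth_default ?mul0r.
case/eqpP=> -[c1 c2] /= /andP[c1_0 c2_0] /polyP E.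
have := E 0%N; rewrite !coefZ coef_comp_polyZX expr0 mulr1 => /(mulIf d0) Ec.
have := E i; rewrite !coefZ coef_comp_polyZX Ec => /(mulfI c2_0).
by rewrite -[LHS]mulr1 => /(mulfI di).
Qed.

Lemma poly_in_Xn (k : fieldType) (d : {poly k}) s : (0 < s)%N ->
  (forall i, d`_i != 0 -> (s %| i)%N) -> exists f, d = f \Po 'X^s.
Proof.
move=> s0 ds; exists (\poly_(j < size d) d`_(j * s)); apply/polyP => i.
rewrite coef_comp_poly_Xn // coef_poly; case: ifP => [/divnK->|s'i].
  case: ltnP => // le_d; rewrite nth_default //.
  by rewrite (leq_trans le_d) ?leq_div.
by apply: contraFeq s'i => /ds.
Qed.

(** * Characters *)

Lemma char_order_exists (k : fieldType) (G : groupType) (chi : character k G)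
    t :
  (0 < t)%N -> (forall g, chi g ^+ t = 1) -> exists s, char_order chi s.
Proof.
move=> t0 chi_t.
pose P n := (0 < n)%N /\ forall g, chi g ^+ n = 1.
have [|s [s0 chi_s] min_s] := @classical_ex_min P; first by exists t.
by exists s; split=> // i i0 chi_i; apply: min_s.
Qed.

Lemma char_order_dvd (k : fieldType) (G : groupType) (chi : character k G) s t :
  char_order chi s -> (forall g, chi g ^+ t = 1) -> (s %| t)%N.
Proof.
case=> s0 chi_s min_s chi_t; rewrite /dvdn -leqn0 leqNgt; apply/negP => r0.
have : (s <= t %% s)%N.
  apply: min_s => // g; move: (chi_t g); rewrite {1}(divn_eq t s) exprD mulnC
    exprM.
  by rewrite chi_s expr1n mul1r.
by rewrite leqNgt ltn_pmod.
Qed.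

Lemma char_neq0 (k : fieldType) (G : groupType) (chi : character k G) g :
  chi g != 0.
Proof.
apply/eqP => g0; have := charM chi g g^-1%g.
by rewrite mulgV char1 g0 mul0r => /eqP; rewrite oner_eq0.
Qed.

Definition char_mul (k : fieldType) (G : groupType) (chi lam : character k G) :
  character k G.
Proof.
exists (fun g => chi g * lam g); first by rewrite !char1 mulr1.
by move=> g h; rewrite !charM mulrACA.
Defined.

(** * The action of k[x] on weight vectors *)

Section OreModules.
Variables (k : fieldType) (G : groupType) (chi : character k G) (a : G).
Variable H : oreHopf chi a.

(** The elements g x^i span H. *)
Lemma linear_over_generators (M N : lmodType H) (f : M -> N) :
    {morph f : u v / u + v} ->
    (forall (c : k) v, f ((c%:A : H) *: v) = (c%:A : H) *: f v) ->
    (forall g v, f ((grp g : H) *: v) = (grp g : H) *: f v) ->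
    (forall v, f ((gen : H) *: v) = (gen : H) *: f v) ->
  linear f.
Proof.
move=> fD fk fG fx h u v; rewrite fD; congr (_ + _).
have f0 : f 0 = 0 by apply: (addIr (f 0)); rewrite -fD !add0r.
have fxn n w : f ((gen : H) ^+ n *: w) = (gen : H) ^+ n *: f w.
  elim: n => [|n IH]; first by rewrite !expr0 !scale1r.
  by rewrite !exprS -!scalerA fx IH.
rewrite -(gx_coordK h) gx_combE !scaler_suml.
rewrite (big_morph f fD f0); apply: eq_bigr => p _.
by rewrite -mulr_algl -!scalerA fk fG fxn.
Qed.

Lemma grp_gen g : (grp g : H) * gen = (chi g)%:A * gen * grp g.
Proof.
by rewrite -mulrA gen_grp mulr_algl scalerA mulfV ?scale1r ?char_neq0.
Qed.

Lemma grp_alg g (c : k) : (grp g : H) * c%:A = c%:A * grp g.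
Proof. by rewrite mulr_algl mulr_algr. Qed.

Section PolyAct.
Variable M : lmodType H.
Implicit Types (p q : {poly k}) (v w : M).

Definition poly_act p v : M := horner_alg (gen : H) p *: v.

Lemma poly_actB p q v : poly_act (p - q) v = poly_act p v - poly_act q v.
Proof. by rewrite /poly_act rmorphB scalerBl. Qed.
Lemma poly_actD p q v : poly_act (p + q) v = poly_act p v + poly_act q v.
Proof. by rewrite /poly_act rmorphD scalerDl. Qed.
Lemma poly_actM p q v : poly_act (p * q) v = poly_act p (poly_act q v).
Proof. by rewrite /poly_act rmorphM scalerA. Qed.
Lemma poly_actX v : poly_act 'X v = (gen : H) *: v.
Proof. by rewrite /poly_act horner_algX. Qed.
Lemma poly_actC c v : poly_act c%:P v = (c%:A : H) *: v.
Proof. by rewrite /poly_act horner_algC. Qed.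
Lemma poly_act0 v : poly_act 0 v = 0.
Proof. by rewrite /poly_act rmorph0 scale0r. Qed.
Lemma poly_act1 v : poly_act 1 v = v.
Proof. by rewrite /poly_act rmorph1 scale1r. Qed.
Lemma poly_actv0 p : poly_act p 0 = 0.
Proof. by rewrite /poly_act scaler0. Qed.

(** Moving g past x multiplies x by chi(g). *)
Lemma grp_poly_act g p v :
  (grp g : H) *: poly_act p v =
  poly_act (p \Po (chi g *: 'X)) ((grp g : H) *: v).
Proof.
elim/poly_ind: p v => [|p c IH] v; first by rewrite
  comp_poly0 !poly_act0 scaler0.
rewrite comp_poly_MXaddC !poly_actD scalerDr !poly_actM !poly_actC poly_actX
  IH !scalerA grp_alg.
congr (poly_act _ _ + _); rewrite grp_gen -!scalerA -mul_polyC poly_actM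
  poly_actC poly_actX.
by rewrite scalerA.
Qed.

Lemma weight_poly_act lam g p w : weight lam w ->
  (grp g : H) *: poly_act p w = poly_act (lam g *: (p \Po (chi g *: 'X))) w.
Proof.
move=> /(_ g) E.
by rewrite grp_poly_act E -poly_actC -poly_actM mulrC mul_polyC.
Qed.

(** The vectors p(x) w form an H-submodule, because g maps each x^i w to a
    multiple of itself. *)
Lemma weight_cyclic lam w h p : weight lam w ->
  exists q, h *: poly_act p w = poly_act q w.
Proof.
move=> ww; rewrite -(gx_coordK h) gx_combE scaler_suml.
apply: (big_ind (fun v => exists q, v = poly_act q w))
  => [|u v [p1 ->] [p2 ->]|[g i] _].
- by exists 0; rewrite poly_act0.
- by exists (p1 + p2); rewrite poly_actD.
have Xn : (gen : H) ^+ i = horner_alg gen 'X^i.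
  by rewrite [RHS]rmorphXn /= horner_algX.
rewrite /= -mulr_algl -!scalerA Xn -/(poly_act _ _) -poly_actM
  (weight_poly_act _ _ ww) -poly_actC -poly_actM.
by eexists.
Qed.

Lemma simple_cyclic lam w : simple_module M -> weight lam w -> w != 0 ->
  forall v, exists p, v = poly_act p w.
Proof.
case=> _ M_simple ww w0.
have [||P0 |//] := M_simple (fun v => exists p, v = poly_act p w).
- by exists 0; rewrite poly_act0.
- move=> h u v [p ->] [q ->]; have [p' ->] := weight_cyclic h p ww.
  by exists (p' + q); rewrite poly_actD.
by case/eqP: w0; apply: P0; exists 1; rewrite poly_act1.
Qed.

Lemma weight_gen lam w :
  weight lam w -> weight (char_mul chi lam) ((gen : H) *: w).
Proof.
move=> ww g; rewrite -poly_actX (weight_poly_act _ _ ww) comp_polyX scalerA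
  -mul_polyC poly_actM.
by rewrite poly_actC /= mulrC.
Qed.

(** x^s commutes with G when chi^s = 1. *)
Lemma weight_comp_Xn s f lam w : (forall g, chi g ^+ s = 1) ->
  weight lam w -> weight lam (poly_act (f \Po 'X^s) w).
Proof.
move=> chi_s ww g; rewrite (weight_poly_act _ _ ww) -comp_polyA rmorphXn /=
  comp_polyX exprZn.
by rewrite chi_s scale1r -mul_polyC poly_actM poly_actC.
Qed.

End PolyAct.

Lemma comp_Xn_size_le (f u : {poly k}) s : (0 < s)%N -> u != 0 ->
  f \Po 'X^s %| u \Po 'X^s -> (size f <= size u)%N.
Proof.
move=> s0 u0 /dvdp_leq; rewrite comp_poly_eq0 ?size_polyXn // => /(_ u0).
have [->|f0] := eqVneq f 0; first by rewrite size_poly0.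
move=> le; have : ((size (f \Po 'X^s)).-1 <= (size (u \Po 'X^s)).-1)%N.
  by case: (size _) (size _) le => [|m] [].
rewrite !size_comp_poly size_polyXn /= leq_pmul2r //.
by case: (size f) (size u) (size_poly_eq0 u) => [|m] [|n] //=;
  rewrite (negPf u0).
Qed.

(** * The annihilator of a weight vector not killed by x *)

(** The exponents that occur in the generator d of the annihilator are
    multiples of s by its stability under X |-> chi(g) X. Irreducibility of f
    is a form of Schur's lemma: for a divisor q of f = v q, either q(x^s) w = 0
    and f divides q, or q(x^s) w is a weight vector generating M, and then
    v(x^s) kills M. *)
Lemma simple_annihilator (M : lmodType H) lam (w : M) :
    simple_module M -> weight lam w -> (gen : H) *: w != 0 ->
  exists s f, [/\ char_order chi s, Irr f
                & forall p, poly_act p w = 0 <-> f \Po 'X^s %| p].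
Proof.
move=> M_simple ww xw0.
have w0 : w != 0 by apply: contraNneq xw0 => ->; rewrite scaler0.
have [p0 Ew] := simple_cyclic M_simple (weight_gen ww) xw0 w.
pose q0 := 1 - p0 * 'X.
(* q0 kills w and q0(0) = 1, which forces d(0) to be nonzero. *)
have q0_0 : q0`_0 = 1 by rewrite coefB coef1 coefMX subr0.
have [|||d d_monic ann] := @poly_ideal_principal k (fun p => poly_act p w = 0).
- by move=> p q Ip Iq; rewrite poly_actB Ip Iq subr0.
- by move=> p q Iq; rewrite poly_actM Iq poly_actv0.
- exists q0.
    by apply/eqP => E; move/eqP: q0_0; rewrite E coef0 eq_sym oner_eq0.
  by rewrite poly_actB poly_act1 poly_actM poly_actX -Ew subrr.
have d0 : d`_0 != 0.
  have : d %| q0 by apply/ann; rewrite poly_actB poly_act1 poly_actM poly_actX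
    -Ew subrr.
  case/dvdpP => u E; move: q0_0; rewrite E coef0M => E1.
  by apply: contra_eq_neq E1 => ->; rewrite mulr0 eq_sym oner_eq0.
have d1 : (1 < size d)%N.
  rewrite ltnNge; apply: contra w0 => le_d.
  have : d %| 1 by rewrite (size1_polyC le_d) -alg_polyC dvdpZl.
  by move/ann; rewrite poly_act1 => ->.
have chi_d g i : d`_i != 0 -> chi g ^+ i = 1.
  apply: dvdp_scaleX_expr1 => //; apply/ann.
  have : (grp g : H) *: poly_act d w = 0 by rewrite (proj2 (ann d) _) ?scaler0.
  rewrite (weight_poly_act _ _ ww) -mul_polyC poly_actM poly_actC => E.
  by rewrite -[RHS](poly_actv0 _ (lam g)^-1%:P) -E -poly_actC -poly_actM
    -polyCM mulVf ?char_neq0 // poly_act1.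
have [s s_chi] : exists s, char_order chi s.
  apply: (@char_order_exists _ _ _ (size d).-1) => [|g].
    by rewrite -subn1 subn_gt0.
  by apply: chi_d; rewrite -lead_coefE lead_coef_eq0 monic_neq0.
have [s0 chi_s _] := s_chi.
have [|f Ed] := @poly_in_Xn k d s s0.
  by move=> i di; apply: char_order_dvd s_chi _ => g; apply: chi_d.
have f_monic : f \is monic.
  move: d_monic; rewrite Ed !monicE lead_coef_comp ?size_polyXn //.
  by rewrite lead_coefXn expr1n mulr1.
have f0 : f != 0 by rewrite monic_neq0.
have f1 : (1 < size f)%N.
  rewrite ltnNge; apply: contraL d1 => le_f.
  by rewrite Ed (size1_polyC le_f) comp_polyC -leqNgt size_polyC leq_b1.
exists s, f; split=> //; last by rewrite -Ed.
split=> //; last first.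
  by apply: contraNneq d0 => Ef; rewrite Ed Ef comp_polyX coefXn;
    case: s s0 {s_chi chi_s Ed}.
split=> // q q1 q_f; have [v Ef] := dvdpP _ _ q_f.
have /andP[v0 q0'] : (v != 0) && (q != 0) by rewrite -negb_or -mulf_eq0 -Ef.
have [qw0|qw0] := eqVneq (poly_act (q \Po 'X^s) w) 0.
  rewrite -dvdp_size_eqp // eqn_leq dvdp_leq //=.
  by apply: (comp_Xn_size_le s0) => //; rewrite -Ed; apply/ann.
have [p Ewp] := simple_cyclic M_simple (weight_comp_Xn q chi_s ww) qw0 w.
(* w is p(x) q(x^s) w, and v(x^s) q(x^s) w = f(x^s) w = 0. *)
have vd : f \Po 'X^s %| v \Po 'X^s.
  rewrite -Ed; apply/ann; rewrite {1}Ewp -poly_actM mulrC poly_actM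
    -[poly_act (v \Po _) _]poly_actM -comp_polyM -Ef.
  by rewrite (proj2 (ann _)) ?poly_actv0 ?Ed.
have := comp_Xn_size_le s0 v0 vd.
rewrite Ef size_mul //; move: q1; rewrite -size_poly_eq0 in q0'.
by case: (size q) q0' => [|[|j]] //; rewrite !addnS /= ltnNge leq_addr.
Qed.

(** * Comparison with V(lambda, f) *)

Section CyclicModel.
Variables (s : nat) (s_chi : char_order chi s) (lam : character k G).
Variables (f : {poly k}) (f_monic : f \is monic).
Variables (M : lmodType H) (w : M).
Hypothesis ww : weight lam w.
Hypothesis w_cyclic : forall v : M, exists p, v = poly_act p w.
Hypothesis w_ann : forall p, poly_act p w = 0 <-> f \Po 'X^s %| p.

Local Notation n := (size f).-1.

Lemma monic_comp_Xn_split :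
  f \Po 'X^s = 'X^(n * s) - \sum_(j < n) Vf_alpha f j *: 'X^(j * s).
Proof.
have f0 : (0 < size f)%N by rewrite lt0n size_poly_eq0 monic_neq0.
rewrite comp_polyE -(prednK f0) big_ord_recr /= -lead_coefE (monicP f_monic).
rewrite scale1r -exprM mulnC addrC; congr (_ + _).
rewrite -sumrN; apply: eq_bigr => j _.
by rewrite /Vf_alpha scaleNr opprK -exprM mulnC.
Qed.

(** The map m_i |-> x^i w, the coordinates of a vector being read as the
    coefficients of a polynomial. *)
Definition row_act (v : 'rV[k]_(n * s)) : M := poly_act (rVpoly v) w.

Lemma row_actD : {morph row_act : u v / u + v}.
Proof. by move=> u v; rewrite /row_act linearD poly_actD. Qed.

Lemma row_actZ c v : row_act (c *: v) = (c%:A : H) *: row_act v.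
Proof. by rewrite /row_act linearZ /= -mul_polyC poly_actM poly_actC. Qed.

Lemma row_act_sum (I : finType) (F : I -> 'rV[k]_(n * s)) :
  row_act (\sum_i F i) = \sum_i row_act (F i).
Proof.
have r0 : row_act 0 = 0 by rewrite /row_act linear0 poly_act0.
by rewrite (big_morph row_act row_actD r0).
Qed.

Lemma row_act_m i : (i < n * s)%N -> row_act (Vf_m s f i) = poly_act 'X^i w.
Proof.
move=> lt_i; rewrite /row_act; congr poly_act; apply/polyP => j.
rewrite coefXn coef_rVpoly; case: insubP => [l lt_l <-|]; first by rewrite mxE.
by rewrite -leqNgt => le_j; rewrite gtn_eqF // (leq_trans lt_i).
Qed.

(** For the last index, the defining relation of V(lambda, f) says that f(X^s)
    kills m_0; for the others x is a shift on both sides. *)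
Lemma row_act_xm (i : 'I_(n * s)) :
  row_act (Vf_xm s f i) = (gen : H) *: poly_act 'X^i w.
Proof.
have [s0 _ _] := s_chi.
rewrite -poly_actX -poly_actM -exprS /Vf_xm; case: ltnP => [|le_i];
  first exact: row_act_m.
have -> : i.+1 = (n * s)%N by apply/eqP; rewrite eqn_leq le_i ltn_ord.
apply/eqP; rewrite eq_sym -subr_eq0 row_act_sum.
under eq_bigr => j _ do
  rewrite row_actZ row_act_m ?ltn_pmul2r // -poly_actC -poly_actM mul_polyC.
rewrite (_ : \sum_(j < n) _ =
    poly_act (\sum_(j < n) Vf_alpha f j *: 'X^(j * s)) w); last first.
  by rewrite /poly_act rmorph_sum scaler_suml.
by rewrite -poly_actB -monic_comp_Xn_split; apply/eqP/w_ann.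
Qed.

Lemma row_act_gact g v :
  row_act (Vf_gact chi lam g v) = (grp g : H) *: row_act v.
Proof.
rewrite [in RHS]/row_act (weight_poly_act _ _ ww) /row_act; congr poly_act;
  apply/polyP => i.
rewrite coefZ coef_comp_polyZX !coef_rVpoly; case: insubP => [l lt_l <-|_].
  rewrite /Vf_gact summxE (bigD1 l) //= big1 ?addr0 => [|j jl]; rewrite !mxE.
    by rewrite eqxx mulr1 [RHS]mulrC mulrA.
  by rewrite val_eqE eq_sym (negPf jl) !mulr0.
by rewrite mul0r mulr0.
Qed.

Lemma row_act_xact v : row_act (Vf_xact v) = (gen : H) *: row_act v.
Proof.
have -> : row_act v = \sum_i row_act (v 0 i *: Vf_m s f i).
  rewrite -row_act_sum; congr row_act; apply/rowP => i.
  rewrite summxE (bigD1 i) //= big1 ?addr0 => [|j ji];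
    rewrite !mxE ?eqxx ?mulr1 //.
  by rewrite val_eqE eq_sym (negPf ji) mulr0.
rewrite scaler_sumr /Vf_xact row_act_sum; apply: eq_bigr => i _.
by rewrite !row_actZ row_act_xm row_act_m // -!poly_actX -!poly_actC
  -[LHS]poly_actM -[RHS]poly_actM mulrC.
Qed.

(** Vectors of length s deg f are the remainders modulo f(X^s). *)
Lemma row_act_bij : bijective row_act.
Proof.
have [s0 _ _] := s_chi.
have sz : size (f \Po 'X^s) = (n * s).+1.
  have := size_comp_poly f 'X^s; rewrite size_polyXn /= => <-.
  rewrite prednK // lt0n size_poly_eq0 comp_poly_eq0 ?size_polyXn //.
  exact: monic_neq0.
apply: inj_surj_bijective => [u v /eqP|v].
  rewrite -subr_eq0 /row_act -poly_actB -linearB => /eqP/w_ann dv.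
  apply/eqP; rewrite -subr_eq0 -(can_eq rVpolyK) linear0.
  apply: contraTT dv => nz; apply/negP => /(dvdp_leq nz).
  by rewrite sz ltnNge size_poly.
have [p ->] := w_cyclic v; exists (poly_rV (p %% (f \Po 'X^s))).
rewrite /row_act poly_rV_K; last first.
  by rewrite -ltnS -sz ltn_modpN0 // -size_poly_eq0 sz.
apply/eqP; rewrite -subr_eq0 -poly_actB; apply/eqP/w_ann.
by rewrite {1}(divp_eq p (f \Po 'X^s)) addrK dvdp_mull.
Qed.

Lemma cyclic_iso : isomorphic (V_lamf H s_chi lam f) M.
Proof.
pose T : V_lamf H s_chi lam f -> M := row_act.
have T_lin : linear T.
  apply: linear_over_generators => [|c v|g v|v].
  - exact: row_actD.
  - by rewrite gx_scaleE; apply: row_actZ.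
  - by rewrite gx_grpE; apply: row_act_gact.
  - by rewrite gx_genE; apply: row_act_xact.
pose T' : {linear V_lamf H s_chi lam f -> M} :=
  HB.pack T (GRing.isLinear.Build H _ _ *:%R T T_lin).
by exists T'; apply: row_act_bij.
Qed.
End CyclicModel.

(** * Dimensions of the models and the case x w = 0 *)

Lemma has_dim_iso (W : lmodType k) (r : gx_action chi W) (M : lmodType H) n
    (t : W -> 'rV[k]_n) : linear t -> bijective t ->
  isomorphic M (gx_mod r : lmodType H) -> has_dim M n.
Proof.
move=> t_lin t_bij [f f_bij].
have tf_lin : linear (t \o (f : res M -> W)).
  move=> c u v; rewrite /= -t_lin; congr (t _).
  rewrite linearD; congr (_ + _).
  exact: etrans (linearZ_LR f (c%:A : H) u) (gx_scaleE _ _ _).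
pose F : {linear res M -> 'rV[k]_n} :=
  HB.pack (t \o (f : res M -> W)) (GRing.isLinear.Build k _ _ *:%R _ tf_lin).
by exists F; apply: bij_comp.
Qed.

Lemma killed_iso (M : lmodType H) lam (w : M) : weight lam w -> w != 0 ->
    (gen : H) *: w = 0 -> (forall v : M, exists p, v = poly_act p w) ->
  isomorphic (V_lam H lam) M.
Proof.
move=> ww w0 xw0 w_cyclic.
pose T : V_lam H lam -> M := fun c => poly_act (c : k)%:P w.
have T_lin : linear T.
  apply: linear_over_generators => [c e|c e|g e|e].
  - by rewrite /T polyCD poly_actD.
  - by rewrite gx_scaleE /T -poly_actC -poly_actM -polyCM.
  - by rewrite gx_grpE /T (weight_poly_act _ _ ww) comp_polyC scale_polyC.
  - by rewrite gx_genE /T poly_act0 -poly_actX -poly_actM mulrC poly_actM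
    poly_actX xw0 poly_actv0.
pose T' : {linear V_lam H lam -> M} :=
  HB.pack T (GRing.isLinear.Build H _ _ *:%R T T_lin).
exists T'; apply: inj_surj_bijective => [c e|v].
  move/eqP; rewrite -subr_eq0 /= /T -poly_actB -polyCB => /eqP E.
  apply/eqP; rewrite -subr_eq0; apply: contraNT w0 => ce0.
  by rewrite -(poly_act1 w) -polyC1 -(mulVf ce0) polyCM poly_actM E poly_actv0.
have [p ->] := w_cyclic v; exists p`_0.
elim/poly_ind: p => [|p c _]; first by rewrite coef0.
by rewrite /= /T poly_actD poly_actM poly_actX xw0 poly_actv0 add0r coefD
  coefMX coefC add0r.
Qed.
End OreModules.

Theorem theorem3p9 (k : fieldType) (G : groupType) (chi : character k G) (a : G)
    (a_central : forall g : G, (a * g = g * a)%g) (chi_a : chi a != 1)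
    (H : oreHopf chi a) (M : lmodType H)
    (M_simple : simple_module M) (M_weight : weight_module M) :
  (exists n : nat, has_dim M n) /\
  (has_dim M 1 ->
     exists lam : character k G, isomorphic M (V_lam H lam)) /\
  (forall n : nat, (1 < n)%N -> has_dim M n ->
     exists (s : nat) (s_chi : char_order chi s)
            (lam : character k G) (f : {poly k}),
       Irr f /\ isomorphic M (V_lamf H s_chi lam f)).
Proof.
have [lam [w [ww w0]]] : exists lam (w : M), weight lam w /\ w != 0.
  have [[v v0] _] := M_simple; have [/(_ v) [n [lam [w [ww Ev]]]] _] :=
    M_weight.
  have [i w0|w0] := pickP (fun i => w i != 0); first by exists (lam i), (w i).
  by case/eqP: v0; rewrite Ev big1 // => i _; apply/eqP/negbFE/w0.
have [xw0|xw0] := eqVneq ((gen : H) *: w) 0.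
  have iso := isomorphic_sym (killed_iso ww w0 xw0
    (simple_cyclic M_simple ww w0)).
  have dim1 : has_dim M 1.
    apply: (has_dim_iso (r := V_action chi lam) (t := @scalar_mx k 1)) iso.
      by move=> c u v; rewrite raddfD scale_scalar_mx.
    exists (fun v : 'rV[k]_1 => v 0 0) => [c|v]; first by rewrite mxE eqxx.
    by rewrite -mx11_scalar.
  split; first by exists 1%N.
  split=> [_|n n1 dimn]; first by exists lam.
  by move: n1; rewrite -(has_dim_uniq dim1 dimn).
have [s [f [s_chi Irr_f ann]]] := simple_annihilator M_simple ww xw0.
have [f_monic [f1 _] _] := Irr_f.
have iso := isomorphic_sym
  (cyclic_iso s_chi f_monic ww (simple_cyclic M_simple ww w0) ann).
have dimM : has_dim M ((size f).-1 * s).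
  by apply: (has_dim_iso (r := Vf_action s_chi lam f) (t := id)) iso;
    last exists id.
split; first by exists ((size f).-1 * s)%N.
split=> [dim1|n _ _]; last by exists s, s_chi, lam, f.
have := has_dim_uniq dim1 dimM => /esym/eqP; rewrite muln_eq1
  => /andP[_ /eqP s1].
have [_ /(_ a) + _] := s_chi; rewrite s1 expr1 => chi_a1.
by rewrite chi_a1 eqxx in chi_a.
Qed.
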